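(* Let $C$ be the unit circle $x^2+y^2=1$. There are infinitely many rational numbers $s$ such that the point $\left(\frac{2s}{1+s^2},\frac{1-s^2}{1+s^2}\right)\in C(\mathbb{Q})$ lies in (i.e. is a term of) infinitely many geometric progression sequences on $C$ of length at least $3$.
   Context: $C(\mathbb{Q})=\{(x,y)\in\mathbb{Q}^2 : x^2+y^2=1\}$ is the set of rational points on the unit circle $C$. For $r\in\mathbb{Q}$, a sequence of rational points $(x_1,y_1),\ldots,(x_n,y_n)$ in $C(\mathbb{Q})$ is said to form an $r$-geometric progression sequence of length $n$ if $x_i/x_{i-1}=r$ for every $i=2,\ldots,n$ (in particular the denominators $x_{i-1}$ are nonzero). A geometric progression sequence on $C$ is an $r$-geometric progression sequence for some $r\in\mathbb{Q}$; the ratio $r$ may vary from sequence to sequence. *)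

(* Defs.v *)
From mathcomp Require Import all_boot all_order all_algebra.
From mathcomp Require Import boolp classical_sets functions cardinality.

Set Implicit Arguments.
Unset Strict Implicit.
Unset Printing Implicit Defensive.

Import GRing.Theory.

Local Open Scope ring_scope.
Local Open Scope classical_set_scope.

Definition unit_circle : set (rat * rat) :=
  [set p | p.1 ^+ 2 + p.2 ^+ 2 = 1].

(* Division by 0 is 0 in [rat], so the nonvanishing of the denominators has to
   be required separately; the ordinates of the terms are not constrained by
   [r]. *)
Definition geometric_progression (r : rat) (u : seq (rat * rat)) : Prop :=
  (forall p, p \in u -> unit_circle p) /\
  (forall i, (i.+1 < size u)%N ->
     (nth (0, 0) u i).1 != 0 /\
     (nth (0, 0) u i.+1).1 / (nth (0, 0) u i).1 = r).

(* The ratios 1 and -1 are left out: (x, y), (± x, ± y), (x, ± y), ... has such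
   a ratio for any point (x, y) of the circle with x != 0, so that every such
   point lies in infinitely many of these degenerate progressions. *)
Definition nontrivial_geometric_progression (u : seq (rat * rat)) : Prop :=
  exists r : rat, [/\ r != 1, r != -1 & geometric_progression r u].

Definition circle_point (s : rat) : rat * rat :=
  ((2 * s) / (1 + s ^+ 2), (1 - s ^+ 2) / (1 + s ^+ 2)).

(* Main.v *)
(**
  A progression x/r, x, rx of abscissas exists on the circle through (x, y) as
  soon as r^2 - x^2 and 1 - x^2 r^2 are squares; this is a curve of genus 1,
  whose Jacobian is E_x : Y^2 = X (X + 1) (X + x^4).  If p^2 + 1 = q^2 and
  p^2 + x^4 = w^2 then p^2 is the X-coordinate of a point of 2 E_x, and adding
  to it the 4-torsion point with X = - x^2 gives the X-coordinate - (x r)^2,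
  where r = (q w + (1 - x^2) p) / (p^2 + x^2) is an admissible ratio.

  The point of E_x with X = - x is rational when 1 + x + x^2 is a square.
  With x = (1 - g^2) / (1 + g^2) this says that g^4 + 3 is a square, which is
  again a curve of genus 1 with the rational point g = 1/2.

  On both curves duplication lowers the 2-adic valuation of p, resp. g, by
  exactly 1 once it is negative, so one starting point yields infinitely many.
*)

Require Import Defs.
From mathcomp Require Import all_boot all_order all_algebra.
From mathcomp Require Import boolp classical_sets functions cardinality.
From mathcomp Require Import finmap zify ring lra.

Set Implicit Arguments.
Unset Strict Implicit.
Unset Printing Implicit Defensive.

Import Order.TTheory GRing.Theory Num.Theory.

Local Open Scope ring_scope.
Local Open Scope classical_set_scope.

(** * The 2-adic valuation on the rationals, as a relation that fails at 0 *)

Definition val2 (n : int) (q : rat) : Prop :=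
  exists a b : int, q = (2 * a + 1)%:~R / (2 * b + 1)%:~R * 2 ^ n.

Lemma odd_int_neq0 (a : int) : ((2 * a + 1)%:~R : rat) != 0.
Proof. by rewrite intr_eq0; lia. Qed.

Lemma val2_neq0 n q : val2 n q -> q != 0.
Proof.
by move=> [a [b ->]]; rewrite !mulf_neq0 ?invr_eq0 ?odd_int_neq0 ?expfz_neq0.
Qed.

Lemma val2_odd (a : int) : val2 0 (2 * a + 1)%:~R.
Proof. by exists a, 0; rewrite mulr0 add0r divr1 mulr1. Qed.

Lemma val2_1 : val2 0 1.
Proof. exact: (val2_odd 0). Qed.

Lemma val2_2 : val2 1 2.
Proof. by exists 0, 0; rewrite mulr0 add0r divr1 mul1r expr1z. Qed.

Lemma val2_3 : val2 0 3.
Proof. exact: (val2_odd 1). Qed.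

Lemma val2_eq m n q : val2 m q -> m = n -> val2 n q.
Proof. by move=> qm <-. Qed.

Lemma val2M m n p q : val2 m p -> val2 n q -> val2 (m + n) (p * q).
Proof.
move=> [a [b ->]] [c [d ->]].
exists (2 * a * c + a + c), (2 * b * d + b + d).
have -> : 2 * (2 * a * c + a + c) + 1 = (2 * a + 1) * (2 * c + 1) by ring.
have -> : 2 * (2 * b * d + b + d) + 1 = (2 * b + 1) * (2 * d + 1) by ring.
have b0 := odd_int_neq0 b; have d0 := odd_int_neq0 d.
rewrite expfzDr // 2!intrM; move: b0 d0.
move: (_%:~R) (_%:~R) (_%:~R) (_%:~R) (2 ^ m) (2 ^ n) => A B C D M N B0 D0.
by field; rewrite B0 D0.
Qed.

Lemma val2V n q : val2 n q -> val2 (- n) q^-1.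
Proof. by move=> [a [b ->]]; exists b, a; rewrite -invr_expz !invfM invrK [_^-1 * _]mulrC. Qed.

Lemma val2_div m n p q : val2 m p -> val2 n q -> val2 (m - n) (p / q).
Proof. by move=> pm /val2V; apply: val2M. Qed.

Lemma val2X n q k : val2 n q -> val2 (n *+ k) (q ^+ k).
Proof.
move=> qn; elim: k => [|k IH]; first by rewrite mulr0n expr0; exact: val2_1.
by rewrite mulrS exprS; apply: val2M.
Qed.

Lemma val2N n q : val2 n q -> val2 n (- q).
Proof.
by move=> qn; rewrite -mulN1r -[n]add0r; apply: val2M (val2_odd (-1)) qn.
Qed.

Lemma val2D m n p q : val2 m p -> val2 n q -> m < n -> val2 m (p + q).
Proof.
move=> [a [b ->]] [c [d ->]] mn.
have [k ->] : exists k : nat, n = m + k.+1%:Z.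
  by exists (absz (n - m - 1)%R); lia.
(* With the gap written as k + 1, the second term adds the even number 2^(k+1) (2c+1) (2b+1) to an
   odd numerator. *)
exists (2 * a * d + a + d + 2 ^+ k * (2 * c + 1) * (2 * b + 1)),
       (2 * b * d + b + d).
have b0 := odd_int_neq0 b; have d0 := odd_int_neq0 d.
have -> : 2 * (2 * a * d + a + d + 2 ^+ k * (2 * c + 1) * (2 * b + 1)) + 1 =
  (2 * a + 1) * (2 * d + 1) + 2 ^+ k.+1 * (2 * c + 1) * (2 * b + 1) :> int.
  by rewrite exprS; ring.
have -> : 2 * (2 * b * d + b + d) + 1 = (2 * b + 1) * (2 * d + 1) by ring.
rewrite expfzDr // -exprnP.
move: (2 * a + 1) (2 * b + 1) (2 * c + 1) (2 * d + 1) b0 d0 => A B C D b0 d0.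
rewrite intrD !intrM rmorphXn /=.
by field; rewrite d0 b0.
Qed.

Lemma val2B m n p q : val2 m p -> val2 n q -> m < n -> val2 m (p - q).
Proof. by move=> pm /val2N; apply: val2D. Qed.

Lemma val2_le m n q : val2 m q -> val2 n q -> n <= m.
Proof.
move=> [a [b ->]] [c [d e]]; rewrite leNgt; apply/negP => mn.
have [k nE] : exists k : nat, n = m + k.+1%:Z.
  by exists (absz (n - m - 1)%R); lia.
(* Cleared of denominators, an odd integer would equal an even one. *)
have {e} : (2 * a + 1) * (2 * d + 1) = (2 * c + 1) * 2 ^+ k.+1 * (2 * b + 1).
  move: e (odd_int_neq0 b) (odd_int_neq0 d); rewrite nE expfzDr // -exprnP.
  move: (2 * a + 1) (2 * b + 1) (2 * c + 1) (2 * d + 1) => A B C D e B0 D0.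
  apply: (@intr_inj rat); rewrite !intrM rmorphXn /=.
  have m0 : (2 ^ m : rat) != 0 by rewrite expfz_neq0.
  apply: (mulIf m0); transitivity (A%:~R / B%:~R * 2 ^ m * (B%:~R * D%:~R) : rat).
    by field.
  by rewrite e; field.
rewrite exprS; move: (2 ^+ k) => z; nia.
Qed.

Lemma val2_inj m n q : val2 m q -> val2 n q -> m = n.
Proof.
by move=> qm qn; apply/eqP; rewrite eq_le (val2_le qm qn) (val2_le qn qm).
Qed.

(** Elements of distinct valuations are distinct, so choosing one for each k embeds the naturals in
    A. *)
Lemma infinite_val2 (A : set rat) (f : nat -> int) : injective f ->
  (forall k, exists q, A q /\ val2 (f k) q) -> infinite_set A.
Proof.
move=> f_inj /choice[u uA] finA; apply: infinite_nat.
rewrite (_ : [set: nat] = u @^-1` A); last first.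
  by apply/seteqP; split=> // k _; case: (uA k).
apply: finite_preimage finA => k l _ _ e; apply: f_inj.
by apply: (val2_inj (uA k).2); rewrite e; exact: (uA l).2.
Qed.

Lemma finite_roots (F : idomainType) (P : {poly F}) :
  P != 0 -> finite_set [set z | root P z].
Proof.
move=> P0; apply: contrapT => /(infinite_set_fset (size P))[B BP].
rewrite leqNgt => /negP; apply.
by apply: max_poly_roots (fset_uniq B) => //; apply/allP => z /BP.
Qed.

(** * Rational points on h^2 = g^4 + 3 *)

(** The point (g^2, g h) lies on Y^2 = X^3 + 3 X; its double has X = ((g^4 - 3) / (2 g h))^2, a
    square, so the double comes from a point of the quartic again. *)
Lemma quartic_double (g h : rat) : g != 0 -> h != 0 -> h ^+ 2 = g ^+ 4 + 3 ->
  ((g ^+ 8 + 18 * g ^+ 4 + 9) / (4 * g ^+ 2 * h ^+ 2)) ^+ 2 =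
  ((g ^+ 4 - 3) / (2 * g * h)) ^+ 4 + 3.
Proof.
move=> g0 h0 gh.
have h40 : g ^+ 4 + 3 != 0 by rewrite -gh expf_neq0.
have -> : ((g ^+ 4 - 3) / (2 * g * h)) ^+ 4 =
          (g ^+ 4 - 3) ^+ 4 / (16 * g ^+ 4 * (h ^+ 2) ^+ 2) by field; rewrite g0 h0.
by rewrite gh; field; rewrite g0 h40.
Qed.

Lemma quartic_points (k : nat) : exists g h : rat,
  [/\ h ^+ 2 = g ^+ 4 + 3, val2 (- k.+1%:Z) g & val2 (- k.+1%:Z *+ 2) h].
Proof.
elim: k => [|k [g [h [gh Vg Vh]]]].
  exists (1 / 2), (7 / 4); split; first by field.
    exact: val2_div val2_1 val2_2.
  apply: (val2_eq (val2_div (val2_odd 3) (val2X 2 val2_2))); lia.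
have g0 := val2_neq0 Vg; have h0 := val2_neq0 Vh.
exists ((g ^+ 4 - 3) / (2 * g * h)),
       ((g ^+ 8 + 18 * g ^+ 4 + 9) / (4 * g ^+ 2 * h ^+ 2)).
split; first exact: quartic_double.
  (* With v < 0 the valuation of g and 2v that of h, the leading powers dominate: 4v - (1 + v + 2v)
     = v - 1 for the new g, and 8v - (2 + 2v + 4v) = 2 (v - 1) for the new h. *)
  have num : val2 (- k.+1%:Z *+ 4) (g ^+ 4 - 3).
    by apply: val2B (val2X 4 Vg) val2_3 _; lia.
  apply: (val2_eq (val2_div num (val2M (val2M val2_2 Vg) Vh))); lia.
have V18 : val2 1 18 by exact: val2M val2_2 (val2_odd 4).
have V4 : val2 2 4 by exact: val2X 2 val2_2.
have num : val2 (- k.+1%:Z *+ 8) (g ^+ 8 + 18 * g ^+ 4 + 9).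
  apply: val2D (val2D (val2X 8 Vg) (val2M V18 (val2X 4 Vg)) _) (val2_odd 4) _; lia.
apply: (val2_eq (val2_div num (val2M (val2M V4 (val2X 2 Vg)) (val2X 2 Vh)))); lia.
Qed.

(** * Rational p with p^2 + 1 and p^2 + a both squares *)

(** Doubling of (p^2, p q w) on Y^2 = X (X + 1) (X + a): since the 2-torsion is rational, X, X + 1
    and X + a are squares at the double. *)
Lemma square_triple_double (a p q w : rat) : p != 0 -> q != 0 -> w != 0 ->
  q ^+ 2 = p ^+ 2 + 1 -> w ^+ 2 = p ^+ 2 + a ->
  ((p ^+ 4 + 2 * p ^+ 2 + a) / (2 * p * q * w)) ^+ 2 =
    ((p ^+ 4 - a) / (2 * p * q * w)) ^+ 2 + 1 /\
  ((p ^+ 4 + 2 * a * p ^+ 2 + a) / (2 * p * q * w)) ^+ 2 =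
    ((p ^+ 4 - a) / (2 * p * q * w)) ^+ 2 + a.
Proof.
move=> p0 q0 w0 pq pw.
have q20 : p ^+ 2 + 1 != 0 by rewrite -pq expf_neq0.
have w20 : p ^+ 2 + a != 0 by rewrite -pw expf_neq0.
rewrite !expr_div_n !exprMn pq pw.
by split; field; rewrite p0 q20 w20.
Qed.

Lemma square_triples (a p q w : rat) (m : int) : val2 0 a -> 0 < m ->
  q ^+ 2 = p ^+ 2 + 1 -> w ^+ 2 = p ^+ 2 + a ->
  val2 (- m) p -> val2 (- m) q -> val2 (- m) w ->
  infinite_set [set p | p != 0 /\
    exists q w, q ^+ 2 = p ^+ 2 + 1 /\ w ^+ 2 = p ^+ 2 + a].
Proof.
move=> Va m0 pq pw Vp Vq Vw.
apply: (@infinite_val2 _ (fun k => - (m + k%:Z))) => [k l e|k]; first by lia.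
(* The induction carries the valuations of q and w too, as they enter the denominator 2 p q w. As
   p^4 dominates each numerator, a doubling takes -m to -4m - (1 - 3m) = -m - 1. *)
suff [p' [q' [w' [pq' pw' Vp' Vq' Vw']]]] : exists p q w, [/\ q ^+ 2 = p ^+ 2 + 1,
    w ^+ 2 = p ^+ 2 + a, val2 (- (m + k%:Z)) p, val2 (- (m + k%:Z)) q
    & val2 (- (m + k%:Z)) w].
  exists p'; split=> //; split; first exact: val2_neq0 Vp'.
  by exists q', w'.
elim: k => [|k [{Vp Vq Vw pq pw}p [{}q [{}w [pq pw Vp Vq Vw]]]]].
  by exists p, q, w; rewrite addr0.
have [pq' pw'] := square_triple_double (val2_neq0 Vp) (val2_neq0 Vq)
  (val2_neq0 Vw) pq pw.
have Vd := val2M (val2M (val2M val2_2 Vp) Vq) Vw.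
move: pq' pw' Vd; set d := 2 * p * q * w => pq' pw' Vd.
exists ((p ^+ 4 - a) / d), ((p ^+ 4 + 2 * p ^+ 2 + a) / d),
  ((p ^+ 4 + 2 * a * p ^+ 2 + a) / d).
split=> //.
- apply: (val2_eq (val2_div (val2B (val2X 4 Vp) Va _) Vd)); lia.
- have V2p := val2M val2_2 (val2X 2 Vp).
  apply: (val2_eq (val2_div (val2D (val2D (val2X 4 Vp) V2p _) Va _) Vd)); lia.
- have V2p := val2M (val2M val2_2 Va) (val2X 2 Vp).
  apply: (val2_eq (val2_div (val2D (val2D (val2X 4 Vp) V2p _) Va _) Vd)); lia.
Qed.

(** * From such p, with a = x^4, to progressions through (x, y) *)

Lemma sum_squares_neq0 (x p : rat) : x != 0 -> p ^+ 2 + x ^+ 2 != 0.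
Proof.
move=> x0; apply: lt0r_neq0; rewrite ltr_wpDl ?sqr_ge0 //.
by rewrite lt0r sqrf_eq0 x0 sqr_ge0.
Qed.

Lemma ratio_squares (x y p q w r : rat) : x != 0 ->
  x ^+ 2 + y ^+ 2 = 1 -> q ^+ 2 = p ^+ 2 + 1 -> w ^+ 2 = p ^+ 2 + x ^+ 4 ->
  r = (q * w + (1 - x ^+ 2) * p) / (p ^+ 2 + x ^+ 2) ->
  r ^+ 2 - x ^+ 2 = (y * (p * q + w) / (p ^+ 2 + x ^+ 2)) ^+ 2 /\
  1 - (x * r) ^+ 2 = (y * (p * w - x ^+ 2 * q) / (p ^+ 2 + x ^+ 2)) ^+ 2.
Proof.
move=> x0 xy pq pw ->; have N0 := sum_squares_neq0 p x0.
have {xy} xy : y ^+ 2 = 1 - x ^+ 2 by rewrite -xy addrC addKr.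
split; rewrite !expr_div_n ?exprMn xy.
  (* The expansion leaves q and w only in q^2, w^2 and q w; once the squares are replaced, q w
     behaves as a free variable. *)
  have -> : (p * q + w) ^+ 2 = p ^+ 2 * q ^+ 2 + w ^+ 2 + 2 * p * q * w by ring.
  have -> : (q * w + (1 - x ^+ 2) * p) ^+ 2 = q ^+ 2 * w ^+ 2 +
    2 * (1 - x ^+ 2) * p * q * w + (1 - x ^+ 2) ^+ 2 * p ^+ 2 by ring.
  by rewrite pq pw; field.
have -> : (p * w - x ^+ 2 * q) ^+ 2 =
  p ^+ 2 * w ^+ 2 + x ^+ 4 * q ^+ 2 - 2 * x ^+ 2 * p * q * w by ring.
have -> : (q * w + (1 - x ^+ 2) * p) ^+ 2 = q ^+ 2 * w ^+ 2 +
  2 * (1 - x ^+ 2) * p * q * w + (1 - x ^+ 2) ^+ 2 * p ^+ 2 by ring.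
by rewrite pq pw; field.
Qed.

(** Its roots include every [p] that can lead to the ratio [r]: it is obtained
    by eliminating [q w] from the formula for [r]. *)
Definition ratio_poly (x r : rat) : {poly rat} :=
  (r *: ('X^2 + (x ^+ 2)%:P) - (1 - x ^+ 2) *: 'X) ^+ 2
  - ('X^2 + 1) * ('X^2 + (x ^+ 4)%:P).

Lemma ratio_poly_neq0 (x r : rat) : x != 0 -> r != 1 -> r != -1 ->
  ratio_poly x r != 0.
Proof.
move=> x0 r1 rN1; apply/eqP => /(congr1 (horner^~ 0)) /eqP; apply/negP.
rewrite !hornerE /=.
have -> : (r * x * x) ^+ 2 - x ^+ 4 = x ^+ 4 * ((r - 1) * (r - -1)) by ring.
by rewrite !mulf_neq0 ?expf_neq0 ?subr_eq0.
Qed.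

Lemma root_ratio_poly (x p q w : rat) : x != 0 ->
  q ^+ 2 = p ^+ 2 + 1 -> w ^+ 2 = p ^+ 2 + x ^+ 4 ->
  root (ratio_poly x ((q * w + (1 - x ^+ 2) * p) / (p ^+ 2 + x ^+ 2))) p.
Proof.
move=> x0 pq pw; rewrite /root !hornerE /= divfK ?sum_squares_neq0 //.
by rewrite addrK -pq -pw exprMn subrr.
Qed.

Lemma ratio_nontrivial (x p q w r : rat) : x != 0 -> 1 - x ^+ 2 != 0 -> p != 0 ->
  q ^+ 2 = p ^+ 2 + 1 -> w ^+ 2 = p ^+ 2 + x ^+ 4 ->
  r = (q * w + (1 - x ^+ 2) * p) / (p ^+ 2 + x ^+ 2) ->
  r ^+ 2 != 1.
Proof.
move=> x0 x1 p0 pq pw rE; have N0 := sum_squares_neq0 p x0.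
have r0 : r * (p ^+ 2 + x ^+ 2) - (1 - x ^+ 2) * p = q * w.
  by rewrite rE divfK // addrK.
apply/eqP => r1.
(* Squaring [r0] with r^2 = 1 leaves only the cross term, because (p^2 + x^2)^2 + (1 - x^2)^2 p^2 =
   (p^2 + 1) (p^2 + x^4). *)
have : r * ((1 - x ^+ 2) * (p * (p ^+ 2 + x ^+ 2))) = 0.
  have := congr1 (fun z => z ^+ 2) r0; rewrite exprMn pq pw.
  have -> : (r * (p ^+ 2 + x ^+ 2) - (1 - x ^+ 2) * p) ^+ 2 =
    r ^+ 2 * (p ^+ 2 + x ^+ 2) ^+ 2 + (1 - x ^+ 2) ^+ 2 * p ^+ 2
    - 2 * (r * ((1 - x ^+ 2) * (p * (p ^+ 2 + x ^+ 2)))) by ring.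
  rewrite r1 => e; lra.
apply/eqP; rewrite !mulf_neq0 //.
by rewrite -(sqrf_eq0 r) r1 oner_eq0.
Qed.

Lemma geometric_triple (x y z z' r : rat) : x != 0 -> r ^+ 2 != 1 ->
  x ^+ 2 + y ^+ 2 = 1 -> r ^+ 2 - x ^+ 2 = z ^+ 2 ->
  1 - (x * r) ^+ 2 = z' ^+ 2 ->
  nontrivial_geometric_progression [:: (x / r, z / r); (x, y); (x * r, z')].
Proof.
move=> x0 r1 xy rz rz'; have r0 : r != 0.
  apply: contraNneq x0 => r0; move: rz; rewrite r0 expr0n sub0r => /eqP.
  by rewrite eq_sym -addr_eq0 paddr_eq0 ?sqr_ge0 // sqrf_eq0 sqrf_eq0 => /andP[].
have {r1} /norP[r1 rN1] : ~~ ((r == 1) || (r == -1)) by rewrite -sqrf_eq1.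
exists r; split=> //; split=> [u|[|[|//]] _] /=.
- rewrite !inE => /or3P[]/eqP-> //=; rewrite /unit_circle /=; last first.
    by rewrite -rz' addrC subrK.
  by rewrite !expr_div_n -mulrDl -rz addrC subrK divff // expf_neq0.
- by split; [rewrite mulf_neq0 ?invr_eq0|rewrite invfM invrK mulrA divff ?mul1r].
- by split; rewrite // mulrAC divff ?mul1r.
Qed.

(** The map from p to r is finite-to-one, since p is a root of [ratio_poly x r]: finitely many
    progressions would leave finitely many r, hence finitely many p. *)
Lemma infinite_progressions (x y : rat) : x != 0 -> 1 - x ^+ 2 != 0 ->
  x ^+ 2 + y ^+ 2 = 1 ->
  infinite_set [set p | p != 0 /\
    exists q w, q ^+ 2 = p ^+ 2 + 1 /\ w ^+ 2 = p ^+ 2 + x ^+ 4] ->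
  infinite_set [set u : seq (rat * rat) | [/\ (3 <= size u)%N,
    nontrivial_geometric_progression u & (x, y) \in u]].
Proof.
move=> x0 x1 xy infp finu; apply: infp.
set U := [set u | _] in finu.
(* This recovers r from the third abscissa x r of the triples built below. On other members of U the
   value may be arbitrary, and the guard [ratio_poly x r != 0] keeps each fibre finite even then. *)
pose ratio (u : seq (rat * rat)) := (nth (0, 0) u 2).1 / x.
apply: (@sub_finite_set _ _ (\bigcup_(r in ratio @` U)
    [set p | ratio_poly x r != 0 /\ root (ratio_poly x r) p])).
  move=> p [p0 [q [w [pq pw]]]].
  set r := (q * w + (1 - x ^+ 2) * p) / (p ^+ 2 + x ^+ 2).
  have r1 := ratio_nontrivial x0 x1 p0 pq pw (erefl r).
  have [rz rz'] := ratio_squares x0 xy pq pw (erefl r).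
  exists r; last first.
    split; last exact: root_ratio_poly.
    by move: r1; rewrite sqrf_eq1 => /norP[]; exact: ratio_poly_neq0.
  exists [:: (x / r, y * (p * q + w) / (p ^+ 2 + x ^+ 2) / r); (x, y);
    (x * r, y * (p * w - x ^+ 2 * q) / (p ^+ 2 + x ^+ 2))].
    split=> //; first exact: geometric_triple.
    by rewrite !inE eqxx orbT.
  by rewrite /ratio /= mulrAC divff ?mul1r.
apply: bigcup_finite => [|r _]; first exact: finite_image.
have [P0|P0] := eqVneq (ratio_poly x r) 0.
  by rewrite (_ : mkset _ = set0) // -subset0 => p [].
by apply: sub_finite_set (finite_roots P0) => p [].
Qed.

(** * Circle points coming from the quartic *)

Lemma infinite_progressions_quartic (g h : rat) (m : int) :
  h ^+ 2 = g ^+ 4 + 3 -> 0 < m -> val2 (- m) g -> val2 (- m *+ 2) h ->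
  infinite_set [set u : seq (rat * rat) | [/\ (3 <= size u)%N,
    nontrivial_geometric_progression u
    & circle_point ((1 - g) / (1 + g)) \in u]].
Proof.
move=> gh m0 Vg Vh.
have g0 := val2_neq0 Vg.
have Vg1 : val2 (- m *+ 2) (1 + g ^+ 2).
  by rewrite addrC; apply: val2D (val2X 2 Vg) val2_1 _; lia.
have g20 := val2_neq0 Vg1.
have g10 : 1 + g != 0.
  by rewrite addrC; apply: val2_neq0 (val2D Vg val2_1 _); lia.
set x := (1 - g ^+ 2) / (1 + g ^+ 2).
(* Replacing s by (1 - s) / (1 + s) swaps the two coordinates of [circle_point s]. *)
have -> : circle_point ((1 - g) / (1 + g)) = (x, 2 * g / (1 + g ^+ 2)).
  have s0 : (1 + g) ^+ 2 + (1 - g) ^+ 2 != 0.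
    have -> : (1 + g) ^+ 2 + (1 - g) ^+ 2 = 2 * (1 + g ^+ 2) by ring.
    by rewrite mulf_neq0.
  by rewrite /circle_point /x; congr (_, _); field; rewrite g10 g20 s0.
(* The term g^2 dominates both numerator and denominator of x, so x^4 is a 2-adic unit, as
   [square_triples] requires of a. *)
have Vx : val2 0 x.
  rewrite -[0](subrr (- m *+ 2)); apply: val2_div Vg1.
  rewrite -opprB; apply: val2N; apply: val2B (val2X 2 Vg) val2_1 _; lia.
have x0 := val2_neq0 Vx.
apply: infinite_progressions => //.
- have -> : 1 - x ^+ 2 = (2 * g / (1 + g ^+ 2)) ^+ 2 by rewrite /x; field.
  by rewrite expf_neq0 // !mulf_neq0 // invr_eq0.
- by rewrite /x; field.
have Vx2 := val2X 2 Vx.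
(* Twice the point of E_x with X = - x, translated by (0, 0). *)
apply: (@square_triples _ (x * h) (x ^+ 2 * (1 + g ^+ 2) + 1)
  (x * (g ^+ 4 + g ^+ 2 + 2) / (1 + g ^+ 2)) (m *+ 2)).
- exact: val2X 4 Vx.
- lia.
- by rewrite [(x * h) ^+ 2]exprMn gh /x; field.
- by rewrite [(x * h) ^+ 2]exprMn gh /x; field.
- by apply: (val2_eq (val2M Vx Vh)); lia.
- apply: (val2_eq (val2D (val2M Vx2 Vg1) val2_1 _)); lia.
- have V4 : val2 (- m *+ 4) (g ^+ 4 + g ^+ 2 + 2).
    by apply: val2D (val2D (val2X 4 Vg) (val2X 2 Vg) _) val2_2 _; lia.
  apply: (val2_eq (val2_div (val2M Vx V4) Vg1)); lia.
Qed.

Theorem corollary3p2 :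
  infinite_set
    [set s : rat |
      infinite_set
        [set u : seq (rat * rat) |
          [/\ (3 <= size u)%N,
              nontrivial_geometric_progression u
            & circle_point s \in u]]].
Proof.
set A := [set s | _] => finA.
(* The valuations are known for g, not for s; the involution s -> (1 - s) / (1 + s) brings A to the
   g side. *)
have : infinite_set ((fun s : rat => (1 - s) / (1 + s)) @` A).
  apply: (@infinite_val2 _ (fun k => - k.+1%:Z)) => [k l|k]; first by lia.
  have [g [h [gh Vg Vh]]] := quartic_points k.
  have g10 : 1 + g != 0.
    by rewrite addrC; apply: val2_neq0 (val2D Vg val2_1 _); lia.
  exists g; split=> //; exists ((1 - g) / (1 + g)); last first.
    have g2 : 1 + g + (1 - g) != 0 by rewrite addrACA subrr addr0.
    by rewrite /=; field; rewrite g10 g2.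
  by apply: (infinite_progressions_quartic gh _ Vg Vh); lia.
by apply; exact: finite_image.
Qed.
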